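(* Let $n\in\{1,2,\dots\}$. Then the minimum $\hat{G}_n$ of $MG_{n,\delta}$ over $\delta\in(n,n+1)$ is given by $$\hat{G}_n=(-1)^{n+1}\Bigl(e^{-1}-\Bigl(1-\frac{1}{1!}+\dots+(-1)^n\frac{1}{n!}\Bigr)\Bigr),$$ and is assumed for $$\delta=\delta_{n,G}=\Bigl[(-1)^{n+1}\,n!\Bigl(e^{-1}-\Bigl(1-\frac{1}{1!}+\dots+(-1)^n\frac{1}{n!}\Bigr)\Bigr)\Bigr]^{-1}-1.$$
   Context: For $n\in\{1,2,\dots\}$ and $\delta\in(n,n+1)$, $$G_{n,\delta}(u)=(-1)^{n+1}\,\frac{e^{-u}-\Bigl(1-\frac{u^1}{1!}+\dots+(-1)^n\frac{u^n}{n!}\Bigr)}{u^{\delta}}\quad(u>0),\qquad G_{n,\delta}(0)=0,$$ and $MG_{n,\delta}=\max_{u\ge 0}G_{n,\delta}(u)$ (the maximum is attained). *)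

(* Defs.v *)
From HB Require Import structures.
From mathcomp Require Import all_boot all_order all_algebra.
From mathcomp Require Import all_classical all_reals all_analysis.
Set Implicit Arguments.
Unset Strict Implicit.
Unset Printing Implicit Defensive.
Import Order.TTheory GRing.Theory Num.Theory.
Local Open Scope classical_set_scope.
Local Open Scope ring_scope.

Definition is_maximum (R : realType) (A : set R) (m : R) : Prop :=
  A m /\ ubound A m.

Definition is_minimum (R : realType) (A : set R) (m : R) : Prop :=
  A m /\ lbound A m.

(* If A has no maximum, the value is the junk value 0. *)
Definition max_of (R : realType) (A : set R) : R := xget 0 (is_maximum A).

Definition taylor_expN (R : realType) (n : nat) (u : R) : R :=
  \sum_(k < n.+1) (-1) ^+ k * (u ^+ k / k`!%:R).

(* Only the values at u >= 0 are meaningful. *)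
Definition G (R : realType) (n : nat) (delta u : R) : R :=
  if 0 < u then
    (-1) ^+ n.+1 * ((expR (- u) - taylor_expN n u) / u `^ delta)
  else 0.

(* For n < delta < n + 1 the junk value of max_of is harmless: G n delta is
   positive on u > 0, so a value 0 would mean that no maximum exists. *)
Definition MG (R : realType) (n : nat) (delta : R) : R :=
  max_of [set G n delta u | u in [set u : R | 0 <= u]].

Definition Ghat (R : realType) (n : nat) : R :=
  (-1) ^+ n.+1 * (expR (- 1) - \sum_(k < n.+1) (-1) ^+ k * (1 / k`!%:R)).

Definition delta_G (R : realType) (n : nat) : R :=
  ((-1) ^+ n.+1 * n`!%:R *
     (expR (- 1) - \sum_(k < n.+1) (-1) ^+ k * (1 / k`!%:R)))^-1 - 1.

(* Main.v *)
Require Import Defs.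
From mathcomp Require Import all_boot all_order all_algebra.
From mathcomp Require Import all_classical all_reals all_analysis.
From mathcomp Require Import ring lra.
Set Implicit Arguments.
Unset Strict Implicit.
Unset Printing Implicit Defensive.
Import Order.TTheory GRing.Theory Num.Theory.
Import numFieldNormedType.Exports.
Local Open Scope classical_set_scope.
Local Open Scope ring_scope.

(** Write [E m u] for the remainder [(-1)^m (e^-u - sum_(k < m) (-u)^k / k!)]
    ([expN_rem] below), so that [G n delta u = E (n+1) u / u^delta] for
    [u > 0].  The function [E (m+1)] is the primitive of [E m] that vanishes
    at 0, and [E m + E (m+1) = u^m / m!].

    At [u = 1] the power [u^delta] is 1 for every [delta], so
    [G n delta 1 = Ghat n] and every maximum is at least [Ghat n].  The bound is
    reached exactly when 1 is a maximum point.  Up to a positive factor the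
    derivative of [G n delta] at [u] is
    [W = u E n u - delta E (n+1) u] ([dG_num]), and [delta_G n] is the solution
    of [W 1 = 0].  So it remains to see that [W] passes from positive to
    negative values at its zero.  Differentiating [W] lowers [n] and [delta] by
    one; after [n+1] steps one arrives at [e^-u] times a decreasing affine
    function, which changes sign at most once, from + to -.  This property is
    inherited by any primitive that vanishes at 0
    ([once_nonpos_then_neg_primitive]), hence climbs back up to [W].

    The range [n < delta_G n < n + 1] is the pair of Leibniz bounds for the
    alternating series of [e^-1], i.e. the positivity of [E (n+2)] and
    [E (n+3)] at 1.  That the maximum exists for every [delta] in the range
    follows from [E (n+1) u <= u^n] and [E (n+1) u <= u^(n+1)], which make
    [G n delta] smaller than [Ghat n] near 0 and near infinity, and from
    compactness in between. *)

(** * Sign of a function from the sign of its derivative *)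

(** Differentiability at 0 is not asked for, so that functions involving a real
    power can be treated on half-lines together with the smooth ones. *)
Lemma MVT_gt0 (R : realType) (f df : R -> R) (a b : R) :
  0 <= a -> a < b ->
  {within `[a, b], continuous f} ->
  (forall x : R, 0 < x -> is_derive x 1 f (df x)) ->
  exists2 c, a < c < b & f b - f a = df c * (b - a).
Proof.
move=> a0 ab cf fdf.
have fdf' x : x \in `]a, b[%R -> is_derive x 1 f (df x).
  by rewrite in_itv /= => /andP[ax _]; apply: fdf; apply: le_lt_trans ax.
have [c] := MVT ab fdf' cf.
by rewrite in_itv /= => cab e; exists c.
Qed.

Lemma is_derive_continuous_within (R : realType) (f df : R -> R) (a b : R) :
  (forall x : R, x \in `[a, b]%R -> is_derive x 1 f (df x)) ->
  {within `[a, b], continuous f}.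
Proof.
move=> fdf; apply: derivable_within_continuous => x xab.
by have := fdf _ xab => ?; apply: ex_derive.
Qed.

(** The form of a single sign change from + to - that survives integration. *)
Definition once_nonpos_then_neg (R : realType) (f : R -> R) : Prop :=
  forall x y, 0 < x -> x < y -> f x <= 0 -> f y < 0.

(** If [f] starts at 0 and has become nonpositive at [x], its derivative was
    nonpositive somewhere before [x], hence is negative from there on. *)
Lemma once_nonpos_then_neg_primitive (R : realType) (f df : R -> R) :
  f 0 = 0 -> (forall x : R, is_derive x 1 f (df x)) ->
  once_nonpos_then_neg df -> once_nonpos_then_neg f.
Proof.
move=> f0 fdf Sdf x y x0 xy fx.
have cf a b : {within `[a, b], continuous f}.
  by apply: is_derive_continuous_within => z _; exact: fdf.
have [c /andP[c0 cx]] := MVT_gt0 (lexx 0) x0 (cf _ _) (fun z _ => fdf z).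
rewrite f0 !subr0 => fxE.
have dc : df c <= 0 by rewrite -(pmulr_lle0 _ x0) -fxE.
have [d /andP[xd dy] fyE] := MVT_gt0 (ltW x0) xy (cf _ _) (fun z _ => fdf z).
have dd : df d < 0 by apply: (Sdf c) => //; exact: lt_trans xd.
have : df d * (y - x) < 0 by rewrite pmulr_llt0 // subr_gt0.
by rewrite -fyE; lra.
Qed.

(** * Remainders of the Taylor expansion of the decreasing exponential *)

Definition expN_rem (R : realType) (m : nat) (u : R) : R :=
  (-1) ^+ m * (expR (- u) - \sum_(k < m) (-1) ^+ k * (u ^+ k / k`!%:R)).

Lemma expN_rem0 (R : realType) (u : R) : expN_rem 0 u = expR (- u).
Proof. by rewrite /expN_rem big_ord0 subr0 expr0 mul1r. Qed.

Lemma expN_remS (R : realType) (m : nat) (u : R) :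
  expN_rem m.+1 u = u ^+ m / m`!%:R - expN_rem m u.
Proof.
rewrite /expN_rem big_ord_recr /= exprS.
have := sqrr_sign R m; rewrite expr2.
set s := (-1) ^+ m; set S := \sum_(_ < _) _; set t := _ / _ => ss.
transitivity ((s * s) * t - s * (expR (- u) - S)); first by ring.
by rewrite ss mul1r.
Qed.

Lemma expN_remS_at0 (R : realType) (m : nat) : expN_rem m.+1 (0 : R) = 0.
Proof.
elim: m => [|m IH]; rewrite expN_remS.
  by rewrite expN_rem0 expr0 fact0 oppr0 expR0 divr1 subrr.
by rewrite IH expr0n /= mul0r subr0.
Qed.

Lemma is_derive_expRN (R : realType) (u : R) :
  is_derive u 1 (fun x : R => expR (- x)) (- expR (- u)).
Proof. by apply: is_derive_eq; rewrite /GRing.scale /=; ring. Qed.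

Lemma is_derive_expfact (R : realType) (m : nat) (u : R) :
  is_derive u 1 (fun x : R => x ^+ m.+1 / m.+1`!%:R) (u ^+ m / m`!%:R).
Proof.
have dX : is_derive u 1 (fun x : R => x ^+ m.+1) (m.+1%:R * u ^+ m).
  have -> : (fun x : R => x ^+ m.+1) = @id R ^+ m.+1.
    by apply/funext => x; rewrite fctE.
  by apply: is_derive_eq; rewrite /GRing.scale /= mulr1.
have -> : (fun x : R => x ^+ m.+1 / m.+1`!%:R) =
    (fun x : R => (m.+1`!%:R)^-1 *: (x ^+ m.+1)).
  by apply/funext => x; rewrite mulrC.
apply: (is_derive_eq (is_deriveZ (m.+1`!%:R)^-1 dX)).
rewrite /GRing.scale /= factS natrM.
have f0 : (m`!%:R : R) != 0 by rewrite pnatr_eq0 -lt0n fact_gt0.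
by field; rewrite f0 /= addrC natr1 pnatr_eq0.
Qed.

Lemma is_derive_expN_rem (R : realType) (m : nat) (u : R) :
  is_derive u 1 (expN_rem m.+1) (expN_rem m u).
Proof.
elim: m u => [|m IH] u.
  have -> : expN_rem 1 = (fun x : R => 1 - expR (- x)).
    by apply/funext => x; rewrite expN_remS expN_rem0 expr0 fact0 divr1.
  have := is_derive_expRN u => ?.
  by apply: is_derive_eq; rewrite expN_rem0; ring.
have -> : expN_rem m.+2 = (fun x : R => x ^+ m.+1 / m.+1`!%:R - expN_rem m.+1 x).
  by apply/funext => x; rewrite expN_remS.
have := is_derive_expfact m u => ?.
by apply: is_derive_eq; rewrite expN_remS.
Qed.

Lemma expN_rem_gt0 (R : realType) (m : nat) (u : R) :
  0 < u -> 0 < expN_rem m u.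
Proof.
elim: m u => [|m IH] u u0; first by rewrite expN_rem0 expR_gt0.
have cf : {within `[0, u], continuous (@expN_rem R m.+1)}.
  by apply: is_derive_continuous_within => z _; exact: is_derive_expN_rem.
have [c /andP[c0 _]] :=
  MVT_gt0 (lexx 0) u0 cf (fun z _ => is_derive_expN_rem m z).
by rewrite expN_remS_at0 !subr0 => ->; rewrite mulr_gt0 ?IH.
Qed.

(** Leibniz bound: the next remainder, which is the first neglected term minus
    this one, is positive. *)
Lemma expN_rem_lt (R : realType) (m : nat) (u : R) :
  0 < u -> expN_rem m u < u ^+ m / m`!%:R.
Proof. by move=> /(expN_rem_gt0 m.+1); rewrite expN_remS subr_gt0. Qed.

(** The bound by the last retained term, which is the sharper one for large
    [u]. *)
Lemma expN_remS_lt (R : realType) (m : nat) (u : R) :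
  0 < u -> expN_rem m.+1 u < u ^+ m / m`!%:R.
Proof. by move=> /(expN_rem_gt0 m); rewrite expN_remS ltrBlDr ltrDl. Qed.

Lemma divr_fact_le (R : realType) (m : nat) (x : R) : 0 <= x -> x / m`!%:R <= x.
Proof.
move=> x0; rewrite ler_pdivrMr ?ltr0n ?fact_gt0 // ler_peMr //.
by rewrite ler1n fact_gt0.
Qed.

(** * Monotonicity of G on both sides of its critical point *)

(** The numerator of the derivative of [expN_rem m.+1 u / u `^ d]. *)
Definition dG_num (R : realType) (m : nat) (d u : R) : R :=
  u * expN_rem m u - d * expN_rem m.+1 u.

Lemma is_derive_dG_num (R : realType) (m : nat) (d u : R) :
  is_derive u 1 (dG_num m.+1 d) (dG_num m (d - 1) u).
Proof.
have := is_derive_expN_rem m u => ?.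
have := is_derive_expN_rem m.+1 u => ?.
rewrite /dG_num.
apply: is_derive_eq.
rewrite /GRing.scale /=; ring.
Qed.

Lemma is_derive_dG_num0 (R : realType) (d u : R) :
  is_derive u 1 (dG_num 0 d) (expR (- u) * (1 - d - u)).
Proof.
have := is_derive_expN_rem 0 u => ?.
have := is_derive_expRN u => ?.
have -> : dG_num 0 d = (fun x : R => x * expR (- x) - d * expN_rem 1 x).
  by apply/funext => x; rewrite /dG_num expN_rem0.
apply: is_derive_eq.
rewrite /GRing.scale /= expN_rem0; ring.
Qed.

(** [1 - d - u] decreases in [u], so the derivative of [dG_num 0 d] has the sign
    pattern; each further integration from 0 preserves it. *)
Lemma dG_num_once_nonpos_then_neg (R : realType) (m : nat) (d : R) :
  once_nonpos_then_neg (dG_num m d).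
Proof.
elim: m d => [|m IH] d.
  apply: (once_nonpos_then_neg_primitive _ (is_derive_dG_num0 d)).
    by rewrite /dG_num mul0r expN_remS_at0 mulr0 subr0.
  move=> x y x0 xy; rewrite pmulr_rle0 ?expR_gt0 // pmulr_rlt0 ?expR_gt0 //.
  by lra.
apply: (once_nonpos_then_neg_primitive _ (is_derive_dG_num m d)) => //.
by rewrite /dG_num mul0r expN_remS_at0 mulr0 subr0.
Qed.

(** Multiplying by [u `^ (- d)] instead of dividing by [u `^ d] makes the power
    rule apply directly; the value at 0 has no meaning. *)
Definition G_pos (R : realType) (m : nat) (d u : R) : R :=
  expN_rem m.+1 u * u `^ (- d).

Lemma G_gt0E (R : realType) (n : nat) (d u : R) :
  0 < u -> G n d u = G_pos n d u.
Proof.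
by move=> u0; rewrite /G /G_pos u0 powRN /expN_rem /taylor_expN mulrA.
Qed.

Lemma is_derive_G_pos (R : realType) (m : nat) (d u : R) : 0 < u ->
  is_derive u 1 (G_pos m d) (dG_num m d u * u `^ (- d - 1)).
Proof.
move=> u0.
have := is_derive_expN_rem m u => ?.
have := is_derive1_powR (- d) u0 => ?.
rewrite /G_pos; apply: is_derive_eq.
have -> : u `^ (- d) = u * u `^ (- d - 1).
  rewrite -[X in X * _](powRr1 (ltW u0)) -powRD; first by congr (_ `^ _); ring.
  by rewrite (gt_eqF u0) implybT.
rewrite /GRing.scale /dG_num /=; ring.
Qed.

Lemma continuous_G_pos (R : realType) (m : nat) (d a b : R) : 0 < a ->
  {within `[a, b], continuous (G_pos m d)}.
Proof.
move=> a0; apply: is_derive_continuous_within => x.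
by rewrite in_itv /= => /andP[ax _]; apply: is_derive_G_pos; apply: lt_le_trans ax.
Qed.

(** A zero of the numerator at 1 is a change of sign from + to -, so 1 is the
    maximum point. *)
Lemma G_pos_le_at1 (R : realType) (m : nat) (d u : R) :
  dG_num m d 1 = 0 -> 0 < u -> G_pos m d u <= G_pos m d 1.
Proof.
move=> d1 u0.
have Dg := @is_derive_G_pos R m d.
have Sd := @dG_num_once_nonpos_then_neg R m d.
have [u1|u1|->] := ltgtP u 1; last by [].
- have [c /andP[uc c1] e] :=
    MVT_gt0 (ltW u0) u1 (continuous_G_pos u0) Dg.
  have c0 := lt_trans u0 uc.
  have dc : 0 < dG_num m d c.
    by rewrite ltNge; apply/negP => /(Sd _ _ c0 c1); rewrite d1 ltxx.
  rewrite -subr_ge0 e !mulr_ge0 ?powR_ge0 ?(ltW dc) //.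
  by rewrite subr_ge0 ltW.
- have [c /andP[c1 cu] e] :=
    MVT_gt0 ler01 u1 (continuous_G_pos ltr01) Dg.
  have dc : dG_num m d c < 0 by apply: (Sd 1) => //; rewrite d1.
  by rewrite -subr_le0 e !mulr_le0_ge0 ?powR_ge0 ?(ltW dc) // subr_ge0 ltW.
Qed.

(** * Existence of the maximum *)

Lemma G_posr1 (R : realType) (n : nat) (d : R) : G_pos n d 1 = expN_rem n.+1 1.
Proof. by rewrite /G_pos powR1 mulr1. Qed.

Lemma GhatE (R : realType) (n : nat) : Ghat R n = expN_rem n.+1 1.
Proof.
rewrite /Ghat /expN_rem; congr (_ * (_ - _)).
by apply: eq_bigr => k _; rewrite expr1n.
Qed.

Lemma G_pos_le_powR (R : realType) (n m : nat) (d u : R) : 0 < u ->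
  expN_rem n.+1 u <= u ^+ m -> G_pos n d u <= u `^ (m%:R - d).
Proof.
move=> u0 h; rewrite /G_pos powRD ?(gt_eqF u0) ?implybT //.
rewrite powR_mulrn; last exact: ltW.
exact: (ler_wpM2r (powR_ge0 _ _) h).
Qed.

(** The threshold is the point where [u `^ (n + 1 - d)], a bound of [G_pos] that
    increases from 0, reaches [Ghat]. *)
Lemma G_pos_small (R : realType) (n : nat) (d u : R) : d < n%:R + 1 ->
  0 < u <= Ghat R n `^ (n%:R + 1 - d)^-1 -> G_pos n d u <= Ghat R n.
Proof.
move=> dn /andP[u0 ua].
have e0 : 0 < n%:R + 1 - d by rewrite subr_gt0.
have g0 : 0 < Ghat R n by rewrite GhatE expN_rem_gt0.
have h : expN_rem n.+1 u <= u ^+ n.+1.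
  by apply: le_trans (divr_fact_le n.+1 (exprn_ge0 _ (ltW u0))); exact/ltW/expN_rem_lt.
apply: (le_trans (G_pos_le_powR d u0 h)).
rewrite -natr1; apply: (le_trans (y := (Ghat R n `^ (n%:R + 1 - d)^-1) `^ (n%:R + 1 - d))).
  by rewrite ge0_ler_powR ?nnegrE ?powR_ge0 ?(ltW u0) ?(ltW e0).
by rewrite -powRrM mulVf ?gt_eqF // powRr1 // ltW.
Qed.

(** The threshold is the point where [u `^ (n - d)], a bound of [G_pos] that
    decreases to 0, reaches [Ghat]. *)
Lemma G_pos_large (R : realType) (n : nat) (d u : R) : n%:R < d ->
  Ghat R n `^ (n%:R - d)^-1 <= u -> G_pos n d u <= Ghat R n.
Proof.
move=> dn bu.
have e0 : 0 < d - n%:R by rewrite subr_gt0.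
have g0 : 0 < Ghat R n by rewrite GhatE expN_rem_gt0.
have b0 := powR_gt0 (n%:R - d)^-1 g0.
have u0 := lt_le_trans b0 bu.
have h : expN_rem n.+1 u <= u ^+ n.
  by apply: le_trans (divr_fact_le n (exprn_ge0 _ (ltW u0))); exact/ltW/expN_remS_lt.
apply: (le_trans (G_pos_le_powR d u0 h)).
apply: (le_trans (y := (Ghat R n `^ (n%:R - d)^-1) `^ (n%:R - d))); last first.
  by rewrite -powRrM mulVf ?subr_eq0 ?lt_eqF // powRr1 // ltW.
rewrite -opprB !powRN lef_pV2 ?posrE ?powR_gt0 // opprB.
by rewrite ge0_ler_powR ?nnegrE ?(ltW u0) ?(ltW e0) ?(ltW b0).
Qed.

Lemma is_maximum_unique (R : realType) (A : set R) (x y : R) :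
  is_maximum A x -> is_maximum A y -> x = y.
Proof.
by move=> [Ax Ux] [Ay Uy]; apply/eqP; rewrite eq_le (Uy _ Ax) (Ux _ Ay).
Qed.

Lemma max_ofE (R : realType) (A : set R) (m : R) : is_maximum A m -> max_of A = m.
Proof.
move=> Am; apply: (@is_maximum_unique _ A) => //.
by apply: xgetPex; exists m.
Qed.

Lemma Ghat_in_range (R : realType) (n : nat) (d : R) :
  [set G n d u | u in [set u : R | 0 <= u]] (Ghat R n).
Proof. by exists 1 => /=; rewrite ?ler01 // G_gt0E ?ltr01 // G_posr1 GhatE. Qed.

(** The values outside a compact interval are at most [Ghat], which is the
    value at 1, so the maximum over an interval containing 1 is global. *)
Lemma G_max_exists (R : realType) (n : nat) (d : R) : n%:R < d < n%:R + 1 ->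
  exists m, is_maximum [set G n d u | u in [set u : R | 0 <= u]] m.
Proof.
move=> /andP[nd dn].
have g0 : 0 < Ghat R n by rewrite GhatE expN_rem_gt0.
pose a := Num.min 1 (Ghat R n `^ (n%:R + 1 - d)^-1).
pose b := Num.max 1 (Ghat R n `^ (n%:R - d)^-1).
have a0 : 0 < a by rewrite lt_min ltr01 powR_gt0.
have a1 : a <= 1 by rewrite ge_min lexx.
have b1 : 1 <= b by rewrite le_max lexx.
have [c] := EVT_max (le_trans a1 b1) (continuous_G_pos (m := n) (d := d) a0).
rewrite in_itv /= => /andP[ac cb] cmax.
have c0 : 0 < c := lt_le_trans a0 ac.
have gc : Ghat R n <= G_pos n d c.
  by rewrite GhatE -(G_posr1 n d) cmax // in_itv /= a1 b1.
exists (G_pos n d c); split.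
  by exists c; [exact: ltW|rewrite G_gt0E].
move=> _ [u /= u0 <-].
move: u0; rewrite [0 <= u]le_eqVlt => /predU1P[<-|u0].
  by rewrite /G ltxx (le_trans (ltW g0)).
rewrite G_gt0E //.
have [ua|au] := leP u a.
  apply: le_trans gc; apply: G_pos_small => //.
  by rewrite u0 (le_trans ua) // ge_min lexx orbT.
have [ub|bu] := leP u b; first by apply: cmax; rewrite in_itv /= ub ltW.
apply: le_trans gc; apply: G_pos_large => //.
by apply: le_trans (ltW bu); rewrite le_max lexx orbT.
Qed.

Lemma MG_is_maximum (R : realType) (n : nat) (d : R) : n%:R < d < n%:R + 1 ->
  is_maximum [set G n d u | u in [set u : R | 0 <= u]] (MG n d).
Proof. by move=> /(G_max_exists (R := R)) /(xgetPex 0). Qed.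

(** * The optimal exponent *)

Lemma delta_GE (R : realType) (n : nat) :
  delta_G R n = (n`!%:R * expN_rem n.+1 1)^-1 - 1.
Proof.
rewrite -GhatE /delta_G /Ghat; congr (_^-1 - 1).
by rewrite mulrCA mulrA.
Qed.

(** By [E n 1 = 1/n! - E (n+1) 1], the equation [E n 1 = d E (n+1) 1] determines
    [d] as [1/(n! E (n+1) 1) - 1]. *)
Lemma dG_num_delta_G_at1 (R : realType) (n : nat) :
  dG_num n (delta_G R n) 1 = 0.
Proof.
have e0 : expN_rem n.+1 (1 : R) != 0 by rewrite gt_eqF // expN_rem_gt0.
have f0 : (n`!%:R : R) != 0 by rewrite pnatr_eq0 -lt0n fact_gt0.
have : expN_rem n.+1 (1 : R) = 1 / n`!%:R - expN_rem n 1.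
  by rewrite expN_remS expr1n.
rewrite /dG_num delta_GE; move: e0; set e := expN_rem n.+1 1 => e0 eE.
have -> : expN_rem n 1 = 1 / n`!%:R - e by rewrite eE; ring.
by field; rewrite e0 f0.
Qed.

(** Since [delta_G + 1] is the inverse of [n! E (n+1) 1], the two inequalities
    are [1/(n+1)! - 1/(n+2)! < E (n+1) 1 < 1/(n+1)!] with the factor [n!]: the
    lower bound is then exactly [1/(n+2)]. *)
Lemma delta_G_itv (R : realType) (n : nat) : n%:R < delta_G R n < n%:R + 1.
Proof.
have e0 : 0 < expN_rem n.+1 (1 : R) by rewrite expN_rem_gt0.
have f0 : 0 < (n`!%:R : R) by rewrite ltr0n fact_gt0.
have n0 : 0 <= (n%:R : R) by [].
have upper : n`!%:R * expN_rem n.+1 (1 : R) < (n%:R + 1)^-1.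
  have := expN_rem_lt n.+1 (@ltr01 R).
  rewrite expr1n factS natrM -natr1 invfM mul1r.
  by rewrite ltr_pdivlMr // mulrC.
have lower : (n%:R + 2)^-1 < n`!%:R * expN_rem n.+1 (1 : R).
  have h := expN_rem_lt n.+2 (@ltr01 R).
  rewrite expN_remS !expr1n !factS !natrM -!natr1 !mul1r ltrBlDl -ltrBlDr in h.
  rewrite -(ltr_pM2l f0) in h; move: h.
  congr (is_true (_ < _)).
  by field; rewrite (gt_eqF f0) !gt_eqF //=; lra.
rewrite delta_GE; move: upper lower.
have := mulr_gt0 f0 e0; set p := _ * _ => p0 upper lower.
have : n%:R + 1 < p^-1.
  by rewrite -[ltLHS]invrK ltf_pV2 ?posrE ?invr_gt0 //; lra.
have : p^-1 < n%:R + 2.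
  by rewrite -[ltRHS]invrK ltf_pV2 ?posrE ?invr_gt0 //; lra.
by move=> h1 h2; apply/andP; split; lra.
Qed.

Lemma MG_delta_G (R : realType) (n : nat) : MG n (delta_G R n) = Ghat R n.
Proof.
apply: max_ofE; split; first exact: Ghat_in_range.
move=> _ [u /= u0 <-].
move: u0; rewrite [0 <= u]le_eqVlt => /predU1P[<-|u0].
  by rewrite /G ltxx GhatE ltW // expN_rem_gt0.
by rewrite G_gt0E // GhatE -(G_posr1 n (delta_G R n)) G_pos_le_at1 ?dG_num_delta_G_at1.
Qed.

Theorem proposition24 (R : realType) (n : nat) (hn : (1 <= n)%N) :
  is_minimum
    [set MG n delta | delta in [set delta : R | n%:R < delta < n%:R + 1]]
    (Ghat R n) /\
  n%:R < delta_G R n < n%:R + 1 /\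
  MG n (delta_G R n) = Ghat R n.
Proof.
split; last by split; [exact: delta_G_itv|exact: MG_delta_G].
split.
  by exists (delta_G R n); [exact: delta_G_itv|exact: MG_delta_G].
move=> _ [d /= nd <-].
by have [_] := MG_is_maximum nd; apply; exact: Ghat_in_range.
Qed.
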